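(* Let $T=(a_1,\ldots,a_k)$ be an admissible $k$-tuple, let $d\in\mathbb{Z}^+\setminus\{1\}$ be such that $p_d>a_k-a_1$, let $m\in\mathbb{Z}^+$ with $m<p_{d-1}\#$ be a position at which $T$ matches $\mathcal{P}_{d-1}$, and let $g\in\mathbb{Z}^+$. Then for the tuple-primorial sieving pattern ${}^\dagger\mathcal{P}^{T,k,d,m}_g$ there exists an $(\alpha,\kappa)$-regular sieving pattern $\mathcal{P}^{d,k,\mathfrak{r}}_{kg}$ with $\alpha=d$ and $\kappa=k$ (that is, there exists a residue sieving sequence $\mathfrak{r}$ for the $(d,k)$-regular prime sieving sequence) such that ${}^\dagger\mathcal{P}^{T,k,d,m}_g=\mathcal{P}^{d,k,\mathfrak{r}}_{kg}$ as functions on $\mathbb{Z}$.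
   Context: $p_i$ is the $i$-th prime; $p_n\#=\prod_{i=1}^n p_i$; $[r]_p=\{x\in\mathbb{Z}:x\equiv r\pmod p\}$. An admissible $k$-tuple $T=(a_1,\ldots,a_k)$ is a collection of integers $a_1<\ldots<a_k$ with $\bigcup_{i=1}^k[a_i]_p\neq\mathbb{Z}$ for every prime $p$. The Eratosthenes sieving pattern $\mathcal{P}_n:\mathbb{Z}\to\{0,1\}$ is the characteristic function of $\mathbb{Z}\setminus\bigcup_{i=1}^n[0]_{p_i}$. $T$ matches a function $\mathcal{P}:\mathbb{Z}\to\{0,1\}$ at position $m\in\mathbb{Z}$ if $\mathcal{P}(m+a_i)=1$ for all $i\in\{1,\ldots,k\}$. For $T,d,m,g$ as in the claim, the tuple-primorial sieving pattern ${}^\dagger\mathcal{P}^{T,k,d,m}_g:\mathbb{Z}\to\{0,1\}$ is defined by ${}^\dagger\mathcal{P}^{T,k,d,m}_g(z)=0$ if there exist $u\in\{1,\ldots,k\}$ and $v\in\{d,\ldots,d+g-1\}$ with $m+a_u+(z-1)p_{d-1}\#\equiv 0\pmod{p_v}$, and ${}^\dagger\mathcal{P}^{T,k,d,m}_g(z)=1$ otherwise. For $\alpha,\kappa\in\mathbb{Z}^+$, the $(\alpha,\kappa)$-regular prime sieving sequence is $\mathfrak{p}_n=p_{\alpha+\lceil n/\kappa\rceil-1}$, $n\in\mathbb{Z}^+$; it is required that each prime $p$ occurs fewer than $p$ times among the $\mathfrak{p}_n$ (i.e. $\kappa<p_\alpha$). A residue sieving sequence for it is a sequence $\mathfrak{r}=(\mathfrak{r}_n)_{n=1}^\infty$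 of non-negative integers such that $\mathfrak{r}_n<\mathfrak{p}_n$ for all $n$, and $\mathfrak{r}_n\neq\mathfrak{r}_{n'}$ whenever $n\neq n'$ and $\mathfrak{p}_n=\mathfrak{p}_{n'}$. The $(\alpha,\kappa)$-regular sieving pattern $\mathcal{P}_n^{\alpha,\kappa,\mathfrak{r}}:\mathbb{Z}\to\{0,1\}$ is the characteristic function of $\mathbb{Z}\setminus\bigcup_{i=1}^n[\mathfrak{r}_i]_{\mathfrak{p}_i}$. *)

(* Defs.v *)
From mathcomp Require Import all_boot all_order all_algebra.

Set Implicit Arguments.
Unset Strict Implicit.
Unset Printing Implicit Defensive.

Import Order.TTheory GRing.Theory Num.Theory.
Local Open Scope ring_scope.

(* Tuples are indexed from 0 by 'I_k, so a_i is [tnth T u] with u = i - 1.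
   Primes and sieving sequences are functions on nat indexed from 1; their value
   at 0 is irrelevant.  Functions from Z to {0,1} have type [int -> bool]. *)

Lemma larger_prime_exists (n : nat) : exists q, (n < q)%N && prime q.
Proof. by have [q lt_nq pr_q] := prime_above n; exists q; rewrite lt_nq. Qed.

Definition next_prime (n : nat) : nat := ex_minn (larger_prime_exists n).

(* p_1 = 2, p_2 = 3, p_3 = 5, ... (and p_0 = 1) *)
Definition nth_prime (i : nat) : nat := iter i next_prime 1%N.

Definition primorial (n : nat) : nat := (\prod_(1 <= i < n.+1) nth_prime i)%N.

Definition residue_class (r : int) (p : nat) : pred int :=
  [pred x : int | (x == r %[mod p%:Z])%Z].

Definition admissible (k : nat) (T : k.-tuple int) : Prop :=
  sorted <%R T /\
  forall p : nat, prime p ->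
    ~ (forall x : int, exists u : 'I_k, x \in residue_class (tnth T u) p).

(* characteristic function of the complement of [r_1]_(q_1), ..., [r_n]_(q_n) *)
Definition sieve (q r : nat -> nat) (n : nat) : int -> bool :=
  fun x => ~~ has (fun i => x \in residue_class (r i)%:Z (q i)) (index_iota 1 n.+1).

Definition eratosthenes_pattern (n : nat) : int -> bool :=
  sieve nth_prime (fun _ => 0%N) n.

Definition matches (k : nat) (T : k.-tuple int) (P : int -> bool) (m : int) : Prop :=
  forall u : 'I_k, P (m + tnth T u) = true.

Definition tuple_primorial_pattern (k : nat) (T : k.-tuple int)
    (d : nat) (m : int) (g : nat) : int -> bool :=
  fun z => ~~ [exists u : 'I_k, has (fun v =>
      (m + tnth T u + (z - 1) * (primorial d.-1)%:Z == 0 %[mod (nth_prime v)%:Z])%Z)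
    (index_iota d (d + g))].

(* the ceiling of n / m, for m > 0 *)
Definition ceil_div (n m : nat) : nat := ((n + m.-1) %/ m)%N.

Definition regular_primes (alpha kappa : nat) : nat -> nat :=
  fun n => nth_prime (alpha + ceil_div n kappa - 1)%N.

(* Each prime p occurs fewer than p times: every duplicate-free list of
   positions n >= 1 with q_n = p has fewer than p entries. *)
Definition prime_sieving_sequence (q : nat -> nat) : Prop :=
  (forall n, (0 < n)%N -> prime (q n)) /\
  forall p : nat, prime p -> forall s : seq nat, uniq s ->
    (forall n, n \in s -> (0 < n)%N /\ q n = p) -> (size s < p)%N.

Definition residue_sieving_sequence (q r : nat -> nat) : Prop :=
  (forall n, (0 < n)%N -> (r n < q n)%N) /\
  forall n n', (0 < n)%N -> (0 < n')%N -> n <> n' -> q n = q n' -> r n <> r n'.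

Definition regular_pattern (alpha kappa : nat) (r : nat -> nat) (n : nat) :
    int -> bool :=
  sieve (regular_primes alpha kappa) r n.

(* Main.v *)
Require Import Defs.
From mathcomp Require Import all_boot all_order all_algebra.
From mathcomp Require Import ring zify.
Import Order.TTheory GRing.Theory Num.Theory.
Local Open Scope ring_scope.

(** Fix a prime [p = p_v] with [v >= d].  As [p] is not a factor of
    [P = p_1 ... p_(d-1)], the map [z |-> m + a_u + (z - 1) P] permutes the
    residues mod [p], so the condition that [p] divides it singles out one
    residue class mod [p] for each [u] ([dvdz_progression]).  The tuple-primorial
    pattern therefore removes, for each of the primes [p_d, ..., p_(d+g-1)], one
    class per entry of the tuple.

    The [k] classes belonging to one prime are distinct.  Indeed the entries of
    the tuple are distinct and lie in an interval of length less than
    [p_d <= p], hence are distinct mod [p] ([tuple_inj_mod]), and [P] is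
    invertible mod [p].  Admissibility leaves a residue mod [p_d] that no entry
    takes, so [k < p_d] ([admissible_size_lt]); this is what makes the regular
    sequence, in which each prime occurs [k] times, a prime sieving sequence.

    It remains to enumerate the pairs (prime, entry) as a single sequence:
    position [i + 1] carries the prime of index [d + i %/ k]
    ([regular_primesS]) and the entry of index [i %% k], and the first [k * g]
    positions exhaust the pairs that occur. *)

(** * The sequence of primes *)

Lemma next_primeP (n : nat) : (n < next_prime n)%N && prime (next_prime n).
Proof. by rewrite /next_prime; case: ex_minnP. Qed.

Lemma nth_prime_prime (i : nat) : (0 < i)%N -> prime (nth_prime i).
Proof. by case: i => // i _; case/andP: (next_primeP (nth_prime i)). Qed.

Lemma leq_nth_prime : {mono nth_prime : i j / (i <= j)%N}.
Proof.
apply: leq_mono; apply: (homo_ltn ltn_trans) => i.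
by case/andP: (next_primeP (nth_prime i)).
Qed.

Lemma nth_prime_inj : injective nth_prime.
Proof. exact: incn_inj leq_nth_prime. Qed.

Lemma coprime_primorial (n v : nat) :
  (n < v)%N -> coprime (primorial n) (nth_prime v).
Proof.
move=> lt_nv; rewrite /primorial big_nat.
apply: (big_ind (fun x => coprime x (nth_prime v))) => [|x y cx cy|i].
- exact: coprime1n.
- by rewrite coprimeMl cx.
case/andP=> i_gt0 le_in; have lt_iv : (i < v)%N by apply: leq_trans le_in _.
have [pr_i pr_v] : prime (nth_prime i) /\ prime (nth_prime v).
  by split; apply: nth_prime_prime => //; apply: leq_trans lt_iv.
by rewrite prime_coprime // dvdn_prime2 // (inj_eq nth_prime_inj) ltn_eqF.
Qed.

(** Shifting positions by one turns the ceiling into a floor, so that position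
    [i.+1] is addressed by the quotient and remainder of [i]. *)
Lemma regular_primesS (alpha kappa i : nat) : (0 < kappa)%N ->
  regular_primes alpha kappa i.+1 = nth_prime (alpha + i %/ kappa).
Proof.
move=> kappa_gt0; rewrite /regular_primes /ceil_div addSnnS prednK //.
by rewrite divnDr // divnn kappa_gt0 addn1 addnS subn1.
Qed.

Lemma regular_primes_sieving (alpha kappa : nat) :
    (0 < alpha)%N -> (0 < kappa)%N -> (kappa < nth_prime alpha)%N ->
  prime_sieving_sequence (regular_primes alpha kappa).
Proof.
move=> alpha_gt0 kappa_gt0 lt_kappa; split=> [[//|i] _|p pr_p s uniq_s s_p].
  by rewrite regular_primesS // nth_prime_prime // addn_gt0 alpha_gt0.
case: s => [|n0 s] in uniq_s s_p *; first exact: prime_gt0.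
have [] := s_p n0 (mem_head _ _).
case: n0 => // i0 in uniq_s s_p * => _; rewrite regular_primesS // => def_p.
apply: (@leq_ltn_trans kappa); last first.
  by apply: leq_trans lt_kappa _; rewrite -def_p leq_nth_prime leq_addr.
rewrite -[leqRHS](size_iota (i0 %/ kappa * kappa).+1).
apply: uniq_leq_size => // n /s_p[]; case: n => // i _.
rewrite regular_primesS // -def_p => /nth_prime_inj/addnI eq_i.
rewrite mem_iota -eq_i addSn !ltnS leq_divM /=.
by rewrite {1}(divn_eq i kappa) ltn_add2l ltn_pmod.
Qed.

(** * Arithmetic progressions modulo a prime *)

(** The residue [z] mod [p] at which the progression [c + (z - 1) * b] meets
    a multiple of [p]; the first Bezout coefficient is an inverse of [b]
    mod [p]. *)
Definition progression_root (b c : int) (p : nat) : nat :=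
  `|((1 - c * (egcdz b p%:Z).1) %% p%:Z)%Z|%N.

Lemma ltn_progression_root (b c : int) (p : nat) :
  (0 < p)%N -> (progression_root b c p < p)%N.
Proof.
move=> p_gt0; rewrite /progression_root -ltz_nat gez0_abs.
  by rewrite ltz_pmod.
by rewrite modz_ge0 // -lt0n.
Qed.

Lemma dvdz_progression (b c z : int) (p : nat) :
    (0 < p)%N -> coprimez b p%:Z ->
  (c + (z - 1) * b == 0 %[mod p%:Z])%Z
    = (z == (progression_root b c p)%:Z %[mod p%:Z])%Z.
Proof.
move=> p_gt0 co_bp; rewrite /progression_root gez0_abs; last first.
  by rewrite modz_ge0 // -lt0n.
rewrite modz_mod !eqz_mod_dvd subr0.
case: egcdzP => u v /=; rewrite (eqP co_bp) => bezout _.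
rewrite -(Gauss_dvdzl (z - _) (p := b)); last by rewrite coprimez_sym.
(* The two dividends differ by [c (1 - u b) = c v p]. *)
have -> : (z - (1 - c * u)) * b = c + (z - 1) * b - c * v * p%:Z.
  have -> : c * v * p%:Z = c * (1 - u * b) by rewrite -bezout; ring.
  by ring.
by rewrite rpredBr ?dvdz_mull.
Qed.

(** * Tuples of small diameter *)

Lemma tuple_inj_mod (k : nat) (T : k.-tuple int) (p i j : nat) :
    sorted <%R T -> T`_k.-1 - T`_0 < p%:Z -> (i < k)%N -> (j < k)%N ->
  (T`_i == T`_j %[mod p%:Z])%Z -> i = j.
Proof.
move=> T_sorted T_diam; wlog lt_ij : i j / (i < j)%N => [IH|] lt_ik lt_jk.
  case: (ltngtP i j) => [lt_ij|lt_ji|->] // eq_ij; first exact: IH.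
  by apply/esym/IH; rewrite // eq_sym.
have T_lt := lt_sorted_ltn_nth 0 T_sorted.
have T_le := lt_sorted_leq_nth 0 T_sorted.
have lt_Tij : T`_i < T`_j by rewrite T_lt ?inE ?size_tuple.
have le_T0i : T`_0 <= T`_i by rewrite T_le ?inE ?size_tuple //; lia.
have le_Tjk : T`_j <= T`_k.-1 by rewrite T_le ?inE ?size_tuple //; lia.
rewrite eq_sym eqz_mod_dvd => /dvdz_mod0P; rewrite modz_small; lia.
Qed.

(** Reduction mod [p] is injective on the entries; if [p <= k] it would be onto,
    and the entries would meet every class mod [p], against admissibility. *)
Lemma admissible_size_lt (k : nat) (T : k.-tuple int) (p : nat) :
  prime p -> admissible T -> T`_k.-1 - T`_0 < p%:Z -> (k < p)%N.
Proof.
move=> pr_p [T_sorted T_adm] T_diam; rewrite ltnNge; apply/negP => le_pk.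
have p_gt0 := prime_gt0 pr_p.
have lt_mod (x : int) : (`|(x %% p%:Z)%Z| < p)%N.
  by rewrite -ltz_nat gez0_abs ?ltz_pmod // modz_ge0 // -lt0n.
have eq_mod (x y : int) :
    `|(x %% p%:Z)%Z|%N = `|(y %% p%:Z)%Z|%N -> (x == y %[mod p%:Z])%Z.
  have ge0_mod w : 0 <= (w %% p%:Z)%Z by rewrite modz_ge0 // -lt0n.
  by move=> eq_xy; rewrite -(gez0_abs (ge0_mod x)) eq_xy gez0_abs.
pose f (u : 'I_k) : 'I_p := Ordinal (lt_mod T`_u).
have f_inj : injective f.
  move=> u w /(congr1 val)/eq_mod eq_uw; apply: val_inj.
  exact: (tuple_inj_mod _ _ _ _ _ T_sorted T_diam (ltn_ord u) (ltn_ord w)).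
apply: (T_adm p pr_p) => x.
have: Ordinal (lt_mod x) \in codom f.
  by apply: inj_card_onto; rewrite ?card_ord.
case/codomP=> u /(congr1 val)/eq_mod eq_xu; exists u.
by rewrite inE (tnth_nth 0).
Qed.

(** * The tuple-primorial pattern as a regular pattern *)

(** The residue removed at position [n], which carries the entry of index
    [n.-1 %% k]. *)
Definition tuple_residue (k : nat) (T : k.-tuple int) (d : nat) (m : int)
    (n : nat) : nat :=
  progression_root (primorial d.-1)%:Z (m + T`_(n.-1 %% k))
                   (regular_primes d k n).

Lemma mem_tuple_residue (k : nat) (T : k.-tuple int) (d : nat) (m z : int)
    (i : nat) : (0 < k)%N -> (0 < d)%N ->
  (z \in residue_class (tuple_residue k T d m i.+1)%:Z
                       (regular_primes d k i.+1))
    = (m + T`_(i %% k) + (z - 1) * (primorial d.-1)%:Z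
         == 0 %[mod (nth_prime (d + i %/ k))%:Z])%Z.
Proof.
move=> k_gt0 d_gt0; rewrite inE /tuple_residue regular_primesS //=.
rewrite -dvdz_progression //.
  by rewrite prime_gt0 // nth_prime_prime // addn_gt0 d_gt0.
by rewrite coprimezE coprime_primorial // prednK // leq_addr.
Qed.

Lemma tuple_residue_sieving (k : nat) (T : k.-tuple int) (d : nat) (m : int) :
    (0 < k)%N -> (0 < d)%N -> sorted <%R T ->
    T`_k.-1 - T`_0 < (nth_prime d)%:Z ->
  residue_sieving_sequence (regular_primes d k) (tuple_residue k T d m).
Proof.
move=> k_gt0 d_gt0 T_sorted T_diam; split=> [[//|i] _|[|i] [|j] // _ _ neq_ij].
  rewrite ltn_progression_root // regular_primesS // prime_gt0 //.
  by rewrite nth_prime_prime // addn_gt0 d_gt0.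
move=> eq_q eq_r; apply: neq_ij.
have eq_div : (i %/ k = j %/ k)%N.
  by move: eq_q; rewrite !regular_primesS // => /nth_prime_inj/addnI.
(* The common residue, as a position [z], solves both congruences. *)
pose z : int := (tuple_residue k T d m i.+1)%:Z.
have zi : z \in residue_class (tuple_residue k T d m i.+1)%:Z
                              (regular_primes d k i.+1) by rewrite inE.
have zj : z \in residue_class (tuple_residue k T d m j.+1)%:Z
                              (regular_primes d k j.+1) by rewrite inE -eq_r.
move: zi zj; rewrite !mem_tuple_residue // -eq_div => /eqP <-.
rewrite eqz_modDr eqz_modDl eq_sym => eq_T.
have T_diam_i : T`_k.-1 - T`_0 < (nth_prime (d + i %/ k))%:Z.
  by apply: lt_le_trans T_diam _; rewrite lez_nat leq_nth_prime leq_addr.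
have eq_mod : (i %% k = j %% k)%N.
  by apply: tuple_inj_mod T_sorted T_diam_i _ _ _; rewrite ?ltn_pmod // eq_sym.
by rewrite (divn_eq i k) (divn_eq j k) eq_div eq_mod.
Qed.

(** Euclidean division by [k] matches the first [k * g] positions with the pairs
    of a prime among [p_d, ..., p_(d+g-1)] and an entry of the tuple. *)
Lemma tuple_primorial_pattern_regular (k : nat) (T : k.-tuple int) (d : nat)
    (m : int) (g : nat) : (0 < k)%N -> (0 < d)%N ->
  tuple_primorial_pattern T d m g
    =1 regular_pattern d k (tuple_residue k T d m) (k * g)%N.
Proof.
move=> k_gt0 d_gt0 z; congr (~~ _); apply/existsP/hasP => [[u]|[[|i]]].
- case/hasP=> v; rewrite mem_index_iota (tnth_nth 0) => /andP[le_dv lt_v] zuv.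
  pose i := ((v - d) * k + u)%N.
  have div_i : (i %/ k = v - d)%N by rewrite divnMDl // divn_small // addn0.
  have mod_i : (i %% k = u)%N by rewrite modnMDl modn_small.
  exists i.+1; last by rewrite mem_tuple_residue // div_i mod_i subnKC.
  rewrite mem_index_iota /= ltnS (mulnC k) -ltn_divLR // div_i.
  by rewrite ltn_subLR.
- by rewrite mem_index_iota.
rewrite mem_index_iota /= ltnS (mulnC k) -ltn_divLR // => lt_i.
rewrite mem_tuple_residue // => zi.
exists (Ordinal (ltn_pmod i k_gt0)); apply/hasP; exists (d + i %/ k)%N.
  by rewrite mem_index_iota leq_addr ltn_add2l.
by rewrite (tnth_nth 0).
Qed.

Theorem lemma3p2 (k : nat) (T : k.-tuple int) (d : nat) (m : int) (g : nat)
    (k_gt0 : (0 < k)%N) (T_adm : admissible T)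
    (d_gt1 : (1 < d)%N) (d_large : T`_k.-1 - T`_0 < (nth_prime d)%:Z)
    (m_gt0 : 0 < m) (m_lt : m < (primorial d.-1)%:Z)
    (m_match : matches T (eratosthenes_pattern d.-1) m)
    (g_gt0 : (0 < g)%N) :
  prime_sieving_sequence (regular_primes d k) /\
  exists r : nat -> nat,
    residue_sieving_sequence (regular_primes d k) r /\
    tuple_primorial_pattern T d m g =1 regular_pattern d k r (k * g)%N.
Proof.
have d_gt0 := ltnW d_gt1; split.
  apply: regular_primes_sieving => //.
  exact: admissible_size_lt (nth_prime_prime d d_gt0) T_adm d_large.
exists (tuple_residue k T d m); split; last exact: tuple_primorial_pattern_regular.
by apply: tuple_residue_sieving => //; case: T_adm.
Qed.
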